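(* Fix a positive integer $d$ and let $\psi>1$ be the unique positive solution of $\psi^d=\psi^{d-1}+1$. (1) If $\{a_n\}_{n=1}^\infty$ is a non-decreasing sequence of positive integers satisfying $\lim_{n\to\infty} a_n^{1/\psi^n}=\infty$, then $$\sum_{n=1}^\infty \frac{1}{a_n a_{n+1}\cdots a_{n+d-1}}$$ is an irrational number. (2) For every $C\in(1,\infty)$ there exists a strictly increasing sequence of positive integers $\{a_n\}_{n=1}^\infty$ satisfying $\lim_{n\to\infty} a_n^{1/\psi^n}=C$ such that $\sum_{n=1}^\infty \frac{1}{a_n a_{n+1}\cdots a_{n+d-1}}$ is a rational number.
   Context: ''Monotonically increasing'' in part (1) means non-decreasing. *)

(* Defs.v *)
From mathcomp Require Export all_boot all_order all_algebra.
From mathcomp Require Export all_classical all_reals all_analysis.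
Export Order.TTheory GRing.Theory Num.Theory.
Export numFieldNormedType.Exports.

Set Implicit Arguments.
Unset Strict Implicit.
Unset Printing Implicit Defensive.

Local Open Scope ring_scope.
Local Open Scope classical_set_scope.

Definition recip_block (R : realType) (d : nat) (a : nat -> nat) (n : nat) : R :=
  (\prod_(n <= i < n + d) (a i)%:R)^-1.

(* Sequences are indexed from 1: the value [a 0] is never used. *)
Definition block_sum (R : realType) (d : nat) (a : nat -> nat) (S : R) : Prop :=
  (\sum_(1 <= n < N) recip_block R d a n) @[N --> \oo] --> S.

Lemma psi_exists_unique (R : realType) (d : nat) : (0 < d)%N ->
  exists psi : R, [/\ 1 < psi, psi ^+ d = psi ^+ d.-1 + 1 &
    forall x : R, 0 < x -> x ^+ d = x ^+ d.-1 + 1 -> x = psi].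
Proof.
case: d => // d _ /=.
have eqE (x : R) : x ^+ d.+1 = x ^+ d + 1 -> x ^+ d * (x - 1) = 1.
  by move=> e; rewrite mulrBr mulr1 -exprSr e addrC addKr.
have gt1 (x : R) : 0 < x -> x ^+ d.+1 = x ^+ d + 1 -> 1 < x.
  move=> x0 /eqE e; rewrite -subr_gt0 -(pmulr_rgt0 _ (exprn_gt0 d x0)) e.
  exact: ltr01.
have no_lt (x y : R) : 1 < x -> x < y -> x ^+ d.+1 = x ^+ d + 1 ->
    y ^+ d.+1 = y ^+ d + 1 -> False.
  move=> x1 xy /eqE ex /eqE ey.
  have x0 : 0 < x := lt_trans ltr01 x1.
  suff : x ^+ d * (x - 1) < y ^+ d * (y - 1) by rewrite ex ey ltxx.
  apply: (@le_lt_trans _ _ (y ^+ d * (x - 1))).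
    apply: ler_wpM2r; first by rewrite subr_ge0 ltW.
    by apply: lerXn2r; rewrite ?nnegrE ltW // (lt_trans x0 xy).
  by rewrite ltr_pM2l ?ltrD2r // exprn_gt0 // (lt_trans x0 xy).
have [||psi] := @poly_ivt R ('X^(d.+1) - 'X^d - 1) 1 2.
- by rewrite ler1n.
- rewrite !hornerE !expr1n subrr sub0r oppr_le0 ler01 /=.
  rewrite exprS mulr_natl mulr2n addrK subr_ge0.
  by rewrite exprn_ege1 // ler1n.
move=> /andP[psi1 _]; rewrite /root !hornerE subr_eq0 subr_eq => /eqP e.
have {}e : psi ^+ d.+1 = psi ^+ d + 1 by rewrite e addrC.
have psi0 : 0 < psi by apply: lt_le_trans psi1.
exists psi; split=> //; first exact: gt1.
move=> x x0 ex; case: (ltgtP x psi) => // h; exfalso.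
- exact: no_lt (gt1 _ x0 ex) h ex e.
- exact: no_lt (gt1 _ psi0 e) h e ex.
Qed.

(* Main.v *)
Require Import Defs.
From mathcomp Require Import ring lra zify.

(* Write [rb n] for the [n]-th term of the series, [A n] for the product
   [a_1 ... a_n], and note that [psi^(n+d) = psi^(n+d-1) + psi^n], so that
   [\sum_(1 <= i < N) psi^i = psi^(N+d-1) - psi^d].

   (1) If the sum were rational with denominator [q], then
   [q A_(N+d-2) \sum_(n >= N) rb n] would be a positive integer for every [N].
   Put [b_n = ln a_n / psi^n], which tends to infinity, and take [M = N + d - 1]
   to be a record of [b].  Monotonicity of [a] bounds that integer by
   [q A_(N-1) \sum_(m >= M) 1 / a_m]; the record property gives
   [A_(N-1) <= a_M exp(- b_M psi^d)], and [a_m >= max(a_M, exp(psi^m))] gives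
   [\sum_(m >= M) 1 / a_m <= K exp(b_M) / a_M].  Since [psi^d >= 2], the integer
   is at most [q K exp(- b_M)], hence less than 1 when [b_M] is large.

   (2) Let [x_n = C^(psi^n)], so that [x_(n+d) = x_(n+d-1) x_n].  Starting from
   a rational remainder [r], choose [a_(N+d-1)] greedily as the largest integer
   such that the remainder [r'] after subtracting [rb N] still satisfies
   [r' a_(N+1) ... a_(N+d-1) <= 1 / (2 x_(N+d))].  Then this product is also at
   least [1 / (4 x_(N+d))], and [2 x_n <= a_n <= 8 x_n] for all [n].  The factors
   2 and 8 disappear in the limit of [a_n^(1/psi^n)], and the remainder tends
   to 0. *)

Set Implicit Arguments.
Unset Strict Implicit.
Unset Printing Implicit Defensive.

Local Open Scope ring_scope.
Local Open Scope classical_set_scope.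

(** * Growth of powers, geometric sums and records of divergent sequences *)

Lemma natr_mulB1_le_exprn (R : realType) (x : R) n : 1 <= x -> n%:R * (x - 1) <= x ^+ n.
Proof.
move=> x1; suff : n%:R * (x - 1) + 1 <= x ^+ n by apply: le_trans; rewrite lerDl.
elim: n => [|n IH]; first by rewrite mul0r add0r expr0.
have := @exprn_ege1 R n _ x1; rewrite exprS -natr1.
by move: IH; set y := x ^+ n; set z := n%:R => *; nra.
Qed.

Lemma cvg_exprn_pinfty (R : realType) (x : R) : 1 < x -> x ^+ n @[n --> \oo] --> +oo.
Proof.
move=> x1; apply/cvgryPge => A.
exists (Num.bound (`|A| / (x - 1))) => // n nN; rewrite /= in nN *.
have x10 : 0 < x - 1 by rewrite subr_gt0.
apply: le_trans (natr_mulB1_le_exprn n (ltW x1)); apply: (le_trans (ler_norm A)).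
rewrite -ler_pdivrMr //; apply: le_trans (_ : (Num.bound (`|A| / (x - 1)))%:R <= _).
  by apply/ltW/archi_boundP; rewrite divr_ge0 // ltW.
by rewrite ler_nat.
Qed.

Lemma sum_exprV_le (R : realType) (x : R) n : 1 < x ->
  \sum_(i < n) x ^- i <= x / (x - 1).
Proof.
move=> x1; have x10 : 0 < x - 1 by rewrite subr_gt0.
have x0 : 0 < x by apply: lt_trans x1.
suff -> : \sum_(i < n) x ^- i = (x - x * x ^- n) / (x - 1).
  by rewrite ler_pM2r ?invr_gt0 // gerBl mulr_ge0 ?invr_ge0 ?exprn_ge0 // ltW.
elim: n => [|n IH]; first by rewrite big_ord0 expr0 invr1 mulr1 subrr mul0r.
rewrite big_ord_recr /= IH exprS.
have xn : x ^+ n != 0 by rewrite expf_neq0 // gt_eqF.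
by field; rewrite xn !gt_eqF.
Qed.

(** Take the least [n >= m] at which [b] reaches a level [K] that dominates both [B] and every [b i]
    with [i < m]. Earlier indices below [m] are beaten by the choice of [K], those from [m] on by
    minimality. *)
Lemma record_large (R : realType) (b : nat -> R) (B : R) m :
  b n @[n --> \oo] --> +oo ->
  exists n, [/\ (m <= n)%N, B <= b n & forall i, (i < n)%N -> b i <= b n].
Proof.
move=> /cvgryPge /(_ (B + \sum_(i < m) `|b i| + `|B|)) [k _ kP].
set K := B + _ + _ in kP.
have ex : exists n, (m <= n)%N && (K <= b n).
  by exists (maxn m k); rewrite leq_maxl /=; apply: kP => /=; rewrite leq_maxr.
case: (ex_minnP ex) => n /andP[mn Kn] nmin.
have s0 : 0 <= \sum_(i < m) `|b i| by apply: sumr_ge0.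
exists n; split=> //.
  by apply: le_trans Kn; rewrite /K -addrA lerDl addr_ge0.
move=> i lt_in; case: (ltnP i m) => im.
  apply: le_trans Kn; apply: (le_trans (ler_norm _)).
  have : `|b i| <= \sum_(i < m) `|b i|.
    by rewrite (bigD1 (Ordinal im)) //= lerDl sumr_ge0.
  move/le_trans; apply; rewrite /K.
  by have := ler_norm (- B); rewrite normrN; lra.
case: (leP K (b i)) => [Kbi|/ltW bi]; last exact: le_trans bi Kn.
by have := nmin i; rewrite im Kbi => /(_ isT); rewrite leqNgt lt_in.
Qed.

(** * Identities for powers of [psi] *)

Lemma psi_exprD (R : realType) (d : nat) (psi : R) n :
  psi ^+ d = psi ^+ d.-1 + 1 ->
  psi ^+ (n + d) = psi ^+ (n + d.-1) + psi ^+ n.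
Proof. by move=> e; rewrite exprD e mulrDr mulr1 exprD. Qed.

Lemma sum_psi_expr (R : realType) (d : nat) (psi : R) N : (0 < d)%N ->
  psi ^+ d = psi ^+ d.-1 + 1 -> (0 < N)%N ->
  \sum_(1 <= i < N) psi ^+ i = psi ^+ (N + d.-1) - psi ^+ d.
Proof.
move=> d0 e; elim: N => // -[_ _|N IH _].
  by rewrite big_geq // add1n prednK // subrr.
rewrite big_nat_recr //= IH //.
have -> : (N.+2 + d.-1 = N.+1 + d)%N by lia.
by rewrite (psi_exprD _ e) addrAC.
Qed.

Lemma big_nat_add_ord (T : Type) (idx : T) (op : T -> T -> T) n e (F : nat -> T) :
  \big[op/idx]_(n <= i < n + e) F i = \big[op/idx]_(i < e) F (n + i)%N.
Proof.
rewrite -{1}(add0n n) big_addn addKn big_mkord.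
by apply: eq_bigr => i _; rewrite addnC.
Qed.

(** * Terms of the series for a monotone sequence *)

Lemma leq_homo_from1 (a : nat -> nat) :
  (forall n, (1 <= n)%N -> (a n <= a n.+1)%N) ->
  forall m n, (1 <= m)%N -> (m <= n)%N -> (a m <= a n)%N.
Proof.
move=> ha m n m1 /subnK <-; elim: (n - m)%N => // k IH.
by apply: leq_trans IH _; rewrite addSn; apply: ha; lia.
Qed.

Lemma recip_block_gt0 (R : realType) d (a : nat -> nat) n :
  (forall i, (n <= i)%N -> (0 < a i)%N) -> 0 < recip_block R d a n.
Proof.
move=> ha; rewrite invr_gt0 big_nat_cond prodr_gt0 // => i.
by rewrite andbT => /andP[ni _]; rewrite ltr0n ha.
Qed.

(** Only the first [d - 1] factors are compared with those of block [N]. The last factor is kept, so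
    that the bound remains summable over [n]. *)
Lemma recip_block_le (R : realType) d (a : nat -> nat) N n : (0 < d)%N ->
  (forall n, (1 <= n)%N -> (0 < a n)%N) ->
  (forall n, (1 <= n)%N -> (a n <= a n.+1)%N) ->
  (1 <= N)%N -> (N <= n)%N ->
  recip_block R d a n <=
    (\prod_(N <= i < N + d.-1) (a i)%:R)^-1 * (a (n + d.-1)%N)%:R^-1.
Proof.
case: d => // e _ a0 amon N1 Nn /=; rewrite /recip_block addnS big_nat_recr ?leq_addr //=.
have P0 m : (1 <= m)%N -> 0 < \prod_(m <= i < m + e) (a i)%:R :> R.
  move=> m1; rewrite big_nat_cond prodr_gt0 // => i; rewrite andbT => /andP[mi _].
  by rewrite ltr0n a0 // (leq_trans m1).
have n1 : (1 <= n)%N by apply: leq_trans Nn.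
have an0 : 0 < (a (n + e)%N)%:R :> R by rewrite ltr0n a0 //; lia.
rewrite invfM ler_pM2r ?invr_gt0 // lef_pV2 ?posrE ?P0 //.
rewrite !big_nat_add_ord; apply: ler_prod => i _.
by rewrite ler0n ler_nat; apply: leq_homo_from1 => //; lia.
Qed.

(** * Irrationality under fast growth *)

Lemma growth_cvg_pinfty (R : realType) (psi : R) (a : nat -> nat) : 1 < psi ->
  (forall n, (1 <= n)%N -> (0 < a n)%N) ->
  (a n)%:R `^ (1 / psi ^+ n) @[n --> \oo] --> +oo ->
  ln (a n)%:R / psi ^+ n @[n --> \oo] --> +oo.
Proof.
move=> psi1 a0 /cvgryPge h; apply/cvgryPge => A.
(* The shift to [k.+1] excludes index 0, where [a] may vanish. *)
have [k _ kP] := h (expR A); exists k.+1 => // n /= kn.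
have n1 : (1 <= n)%N by apply: leq_trans kn.
have := kP n (ltnW kn); rewrite /= /powR pnatr_eq0 eqn0Ngt a0 //=.
by rewrite ler_expR mulrAC mul1r mulrC.
Qed.

Lemma psi_expr_ge2 (R : realType) (d : nat) (psi : R) : 1 < psi ->
  psi ^+ d = psi ^+ d.-1 + 1 -> 2 <= psi ^+ d.
Proof. by move=> psi1 ->; have := exprn_ege1 d.-1 (ltW psi1); lra. Qed.

(** The bound is on finite tails, uniformly in [N'], so that it can serve twice: with [q = 1] it
    yields convergence of the series, and with [q] the denominator of the sum it contradicts
    integrality. Any constant below 1 would do in place of [2^-1]. *)
Lemma small_tail (R : realType) (d : nat) (psi : R) (a : nat -> nat) (q : R) :
  (0 < d)%N -> 1 < psi -> psi ^+ d = psi ^+ d.-1 + 1 ->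
  (forall n, (1 <= n)%N -> (0 < a n)%N) ->
  (forall n, (1 <= n)%N -> (a n <= a n.+1)%N) ->
  (a n)%:R `^ (1 / psi ^+ n) @[n --> \oo] --> +oo -> 0 < q ->
  exists2 N, (1 <= N)%N & forall N',
    q * \prod_(1 <= i < N + d.-1) (a i)%:R *
      \sum_(N <= n < N') recip_block R d a n <= 2^-1.
Proof.
move=> d0 psi1 psiE a0 amon /(growth_cvg_pinfty psi1 a0); set b := fun n => _ => bcvg q0.
have psi0 : 0 < psi by apply: lt_trans psi1.
set G := psi / (psi - 1).
have G0 : 0 < G by rewrite divr_gt0 // subr_gt0.
have Gle n : \sum_(i < n) psi ^- i <= G := sum_exprV_le n psi1.
clearbody G.
have aE i : (1 <= i)%N -> (a i)%:R = expR (psi ^+ i * b i) :> R.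
  move=> i1; rewrite /b mulrC divfK ?expf_neq0 ?gt_eqF // lnK // posrE ltr0n.
  exact: a0.
have [m _ mP] := (cvgryPge _).1 bcvg 1.
(* The level [2 * q * G] is what makes the final bound [q * G * expR (- b M)] at most 1/2. Starting
   the search at [m + d] ensures [N >= 1] and [b >= 1] from [M] on. *)
have [M [mM BM recM]] := record_large (2 * q * G) (m + d) bcvg.
pose N := (M - d.-1)%N; have NM : (N + d.-1 = M)%N by rewrite /N; lia.
have N1 : (1 <= N)%N by rewrite /N; lia.
exists N => // N'.
have b0 : 0 < b M by apply: lt_le_trans BM; rewrite !mulr_gt0 ?ltr0n.
have aM j : (a (M + j)%N)%:R^-1 <= (a M)%:R^-1 * (expR (b M) * psi ^- j) :> R.
  (* This weakening turns the tail into a geometric series with sum at most [G]. *)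
  have e1 : expR (- psi ^+ j) <= psi ^- j.
    rewrite expRN lef_pV2 ?posrE ?expR_gt0 ?exprn_gt0 //.
    by apply: le_trans (expR_ge1Dx _); rewrite lerDr.
  apply: (@le_trans _ _ ((a M)%:R^-1 * (expR (b M) * expR (- psi ^+ j)))); last first.
    by rewrite ler_pM2l ?invr_gt0 ?ltr0n ?a0 ?ler_pM2l ?expR_gt0 //; lia.
  have ale : (a M)%:R <= (a (M + j)%N)%:R :> R.
    by rewrite ler_nat; apply: leq_homo_from1 => //; lia.
  move: ale; rewrite !aE; [|lia|lia].
  rewrite -!expRN -!expRD !ler_expR => ale.
  have bMj : 1 <= b (M + j)%N by apply: mP => /=; lia.
  have pM := exprn_ege1 M (ltW psi1); have pj := exprn_ege1 j (ltW psi1).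
  move: ale bMj; rewrite exprD; move: (b (M + j)%N) (b M) pM pj.
  move: (psi ^+ M) (psi ^+ j) => u v b' b1 u1 v1 ale b'1.
  (* The claim reads [u b1 + v <= u v b' + b1]. If [v <= b1], monotonicity of [a] suffices;
     otherwise [b' >= 1] reduces it to [(u - 1) (v - b1) >= 0]. *)
  have [vb|bv] := leP v b1; first by lra.
  have : u * v <= u * v * b' by rewrite ler_peMr //; nra.
  by nra.
pose Q : R := \prod_(N <= i < N + d.-1) (a i)%:R.
have Q0 : 0 < Q.
  rewrite /Q big_nat_cond prodr_gt0 // => i; rewrite andbT => /andP[Ni _].
  by rewrite ltr0n a0 // (leq_trans N1).
have sumle : \sum_(N <= n < N') recip_block R d a n <=
    Q^-1 * ((a M)%:R^-1 * (expR (b M) * G)).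
  have [NN'|N'N] := leqP N N'; last first.
    by rewrite big_geq ?(ltnW N'N) // !mulr_ge0 ?invr_ge0 ?expR_ge0 // ltW.
  rewrite -(subnKC NN') big_nat_add_ord.
  apply: (@le_trans _ _ (\sum_(i < N' - N)
      Q^-1 * ((a M)%:R^-1 * (expR (b M) * psi ^- i)))).
    apply: ler_sum => i _; apply: (le_trans (@recip_block_le R d a N _ d0 a0 amon N1 _)).
      exact: leq_addr.
    by rewrite ler_pM2l ?invr_gt0 // addnAC NM aM.
  rewrite -!mulr_sumr ler_pM2l ?invr_gt0 // ler_pM2l ?invr_gt0 ?ltr0n ?a0 //; last by lia.
  by rewrite ler_pM2l ?expR_gt0 // Gle.
have prodle : \prod_(1 <= i < N) (a i)%:R <= expR (b M * (psi ^+ M - psi ^+ d)).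
  rewrite -NM -(sum_psi_expr d0 psiE N1) NM mulr_sumr expR_sum.
  rewrite big_nat_cond [leRHS]big_nat_cond; apply: ler_prod => i.
  rewrite andbT => /andP[i1 iN]; rewrite ler0n /= aE // ler_expR mulrC.
  by rewrite ler_pM2r ?exprn_gt0 // recM //; lia.
rewrite (@big_cat_nat _ _ _ N) //=; [|lia]; rewrite -/Q.
set A := \prod_(1 <= i < N) _ in prodle *.
have A0 : 0 <= A by apply: prodr_ge0.
apply: (@le_trans _ _ (q * (A * Q) * (Q^-1 * ((a M)%:R^-1 * (expR (b M) * G))))).
  by rewrite ler_wpM2l // !mulr_ge0 // ltW.
have -> : q * (A * Q) * (Q^-1 * ((a M)%:R^-1 * (expR (b M) * G))) =
    q * G * (A * ((a M)%:R^-1 * expR (b M))).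
  by rewrite [Q^-1 * _]mulrC !mulrA; field; rewrite ?gt_eqF // ltr0n a0 //; lia.
(* The exponents add up to [b_M (1 - psi^d)], which is at most [- b_M]. *)
have : A * ((a M)%:R^-1 * expR (b M)) <= expR (- b M).
  rewrite aE; last by lia.
  rewrite -expRN -expRD.
  apply: (@le_trans _ _ (expR (b M * (psi ^+ M - psi ^+ d)) *
      expR (- (psi ^+ M * b M) + b M))); first by rewrite ler_pM2r ?expR_gt0.
  rewrite -expRD ler_expR; have := psi_expr_ge2 psi1 psiE; move: b0.
  by move: (psi ^+ M) (psi ^+ d) (b M) => u v w; nra.
have qG : 0 < q * G by rewrite mulr_gt0.
rewrite -(ler_pM2l qG) => /le_trans; apply.
rewrite expRN ler_pdivrMr ?expR_gt0 //.
have := expR_ge1Dx (b M); have {}BM : 2 * q * G <= b M := BM.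
by move: (expR (b M)) (b M) BM => u v *; lra.
Qed.

(** Since [n < N], the last index [n + d - 1] of the block is at most [N + d - 2], so all its
    factors occur in the product and cancel. *)
Lemma prod_recip_block_int (R : realType) (d : nat) (a : nat -> nat) n N :
  (0 < d)%N -> (forall n, (1 <= n)%N -> (0 < a n)%N) -> (1 <= n < N)%N ->
  \prod_(1 <= i < N + d.-1) (a i)%:R * recip_block R d a n \is a Num.int.
Proof.
move=> d0 a0 /andP[n1 nN].
rewrite (@big_cat_nat _ _ _ n) //=; last by lia.
rewrite (@big_cat_nat _ _ _ (n + d) n) //=; [|lia|lia].
set P := \prod_(n <= i < n + d) _.
have P0 : P != 0.
  rewrite /P big_nat_cond prodf_seq_neq0; apply/allP => i _ /=; apply/implyP.
  by rewrite andbT => /andP[ni _]; rewrite pnatr_eq0 -lt0n a0 // (leq_trans n1).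
rewrite /recip_block -/P [P * _]mulrC mulrA mulfK //.
by rewrite rpredM // rpred_prod // => i _; rewrite intr_nat.
Qed.

Lemma block_sum_irrational (R : realType) (d : nat) (psi : R) (a : nat -> nat) :
  (0 < d)%N -> 1 < psi -> psi ^+ d = psi ^+ d.-1 + 1 ->
  (forall n, (1 <= n)%N -> (0 < a n)%N) ->
  (forall n, (1 <= n)%N -> (a n <= a n.+1)%N) ->
  (a n)%:R `^ (1 / psi ^+ n) @[n --> \oo] --> +oo ->
  exists S : R, block_sum d a S /\ irrational S.
Proof.
move=> d0 psi1 psiE a0 amon agrow.
pose u N : R := \sum_(1 <= n < N) recip_block R d a n.
have rb0 n : (1 <= n)%N -> 0 < recip_block R d a n.
  by move=> n1; apply: recip_block_gt0 => i ni; apply: a0; apply: leq_trans ni.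
have uB N N' : (1 <= N)%N -> (N <= N')%N ->
    u N' = u N + \sum_(N <= n < N') recip_block R d a n.
  by move=> N1 NN'; rewrite /u (@big_cat_nat _ _ _ N).
have umon : {homo u : n m / (n <= m)%N >-> n <= m}.
  move=> n m nm; case: n nm => [|n] nm.
    rewrite {1}/u big_geq // /u big_nat_cond sumr_ge0 // => i.
    by rewrite andbT => /andP[i1 _]; rewrite ltW // rb0.
  rewrite (uB n.+1 m) // lerDl big_nat_cond sumr_ge0 // => i.
  by rewrite andbT => /andP[ni _]; rewrite ltW // rb0 // (leq_trans _ ni).
have A1 N : 1 <= \prod_(1 <= i < N + d.-1) (a i)%:R :> R.
  rewrite big_nat_cond; elim/big_ind: _ => // [x y x1 y1|i]; first exact: mulr_ege1.
  by rewrite andbT => /andP[i1 _]; rewrite ler1n a0.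
have ucvg : cvgn u.
  apply: nondecreasing_is_cvgn => //.
  (* With [q = 1] and a prefactor at least 1, the tail itself is at most 1/2, which bounds the
     partial sums. *)
  have [N N1 Nle] := small_tail d0 psi1 psiE a0 amon agrow (@ltr01 R).
  exists (u N + 2^-1) => _ [n _ <-].
  apply: (@le_trans _ _ (u (maxn N n))); first by apply: umon; rewrite leq_maxr.
  rewrite (uB N) ?leq_maxl // lerD2l.
  apply: le_trans (Nle (maxn N n)); rewrite mul1r ler_peMl ?A1 //.
  rewrite big_nat_cond sumr_ge0 // => i.
  by rewrite andbT => /andP[ni _]; rewrite ltW // rb0 // (leq_trans _ ni).
exists (limn u); split; first exact: ucvg.
move=> [r _ rE].
have q0 : 0 < (denq r)%:~R :> R by rewrite ltr0z denq_gt0.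
have [N N1 Nle] := small_tail d0 psi1 psiE a0 amon agrow q0.
set q := (denq r)%:~R in q0 Nle; set A := \prod_(1 <= i < N + d.-1) _ in Nle.
have qA0 : 0 < q * A by rewrite mulr_gt0 // (lt_le_trans ltr01) ?A1.
have zint : q * A * (limn u - u N) \is a Num.int.
  rewrite mulrBr -rE /ratr -/q.
  have -> : q * A * ((numq r)%:~R / q) = A * (numq r)%:~R.
    by field; rewrite gt_eqF.
  rewrite rpredB //.
    by rewrite rpredM ?intr_int // rpred_prod // => i _; rewrite intr_nat.
  rewrite -mulrA rpredM ?intr_int // /u mulr_sumr big_nat_cond rpred_sum // => i.
  by rewrite andbT => iN; apply: prod_recip_block_int.
have zgt0 : 0 < q * A * (limn u - u N).
  rewrite mulr_gt0 // subr_gt0; apply: lt_le_trans (nondecreasing_cvgn_le umon ucvg N.+1).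
  by rewrite (uB N N.+1) // big_nat1 ltrDl rb0.
have zle : q * A * (limn u - u N) <= 2^-1.
  rewrite mulrC -ler_pdivlMr // lerBlDl; apply: limr_le => //.
  near=> N'; have NN' : (N <= N')%N by near: N'; exists N.
  by rewrite (uB N N') // lerD2l ler_pdivlMr // mulrC.
move: zint => /intrP[z zE]; move: zgt0 zle; rewrite zE ltr0z => z0.
have : 1 <= z%:~R :> R by rewrite ler1z.
by lra.
Unshelve. all: by end_near. Qed.

(** * The greedy construction *)

(** Here [w = r a_N ... a_(N+d-2)] is the scaled remainder, [x = x_(N+d-1)], [y = x_N], [b = a_N],
    and [v] is the new term. With [h = b / (2 x y)], the upper bound on the new scaled remainder
    says [v w - 1 <= h], so [v] is the floor of [(1 + h) / w]. Rounding costs less than [w], and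
    [w <= h / 2] saves the lower bound. *)
Lemma greedy_step (R : realType) (w x y b : R) : 4 <= x -> 4 <= y ->
  1 <= 4 * x * w <= 2 -> 2 * y <= b <= 8 * y ->
  exists2 v : nat, 2 * x <= v%:R <= 8 * x &
    1 <= 4 * (x * y) * ((v%:R * w - 1) / b) <= 2.
Proof.
move=> x4 y4 /andP[w1 w2] /andP[b1 b2].
have x0 : 0 < x by lra.
have y0 : 0 < y by lra.
have b0 : 0 < b by lra.
have w0 : 0 < w by nra.
pose h := b / (2 * (x * y)).
have xy0 : 0 < x * y by rewrite mulr_gt0.
have hE : h * (2 * (x * y)) = b by rewrite /h divfK // gt_eqF // mulr_gt0.
have h0 : 0 < h by rewrite divr_gt0 // mulr_gt0.
have hx : h * x <= 4 by have : y * (h * x) <= y * 4 by [nra]; rewrite ler_pM2l.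
have hx1 : 1 <= h * x by have : y * 1 <= y * (h * x) by [nra]; rewrite ler_pM2l.
have t0 : 0 <= (1 + h) / w by rewrite divr_ge0 // ltW // addr_gt0.
exists (Num.trunc ((1 + h) / w)).
  have /andP[] := truncn_itv t0; set v := Num.trunc _.
  rewrite ler_pdivlMr // ltr_pdivrMr // -natr1 => v1 v2.
  have v0 : 0 <= v%:R :> R by [].
  move: (v%:R : R) v0 v1 v2 => z z0 z1 z2.
  apply/andP; split.
    have hw : w <= h by nra.
    have zw : 1 <= z * w by lra.
    have : 4 * x <= 4 * x * w * z by nra.
    by nra.
  have : z * w * (4 * x) <= (1 + h) * (4 * x) by rewrite ler_wpM2r //; lra.
  by nra.
have /andP[] := truncn_itv t0; set v := Num.trunc _.
rewrite ler_pdivlMr // ltr_pdivrMr // -natr1 => v1 v2.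
move: (v%:R : R) v1 v2 => z z1 z2.
rewrite mulrA ler_pdivlMr // ler_pdivrMr // mul1r.
apply/andP; split; last by nra.
have e1 : h - w <= z * w - 1 by lra.
have : 4 * (x * y) * (h - w) <= 4 * (x * y) * (z * w - 1) by rewrite ler_pM2l // mulr_gt0.
apply: le_trans.
have : y * (4 * x * w) <= y * 2 by rewrite ler_pM2l.
by nra.
Qed.

(* The case [d = 1], where the divisor [b] of [greedy_step] is the new term [v]
   itself. *)
Lemma greedy_step1 (R : realType) (w x : R) : 4 <= x ->
  1 <= 4 * x * w <= 2 ->
  exists2 v : nat, 2 * x <= v%:R <= 8 * x &
    1 <= 4 * (x * x) * (w - v%:R^-1) <= 2.
Proof.
move=> x4 /andP[w1 w2].
have x0 : 0 < x by lra.
(* [h] is the largest remainder allowed after the step, and [w - 1/v <= h] means [v <= 1 / (w - h)];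
   [v] is the floor of the latter. *)
pose h := (2 * (x * x))^-1.
have xx0 : 0 < x * x by rewrite mulr_gt0.
have hE : h * (x * x) = 2^-1 by rewrite /h; field; rewrite gt_eqF.
have h0 : 0 < h by rewrite invr_gt0 mulr_gt0.
have hx : 8 * x * h <= 1 by have : x * (8 * x * h) <= x * 1 by [nra]; rewrite ler_pM2l.
have wh0 : 0 < w - h by have : x * 0 < x * (w - h) by [nra]; rewrite ltr_pM2l.
have t0 : 0 <= (w - h)^-1 by rewrite invr_ge0 ltW.
have wh1 : 2 * (x * x) * (w - h) <= x - 1.
  have : x * (4 * x * w) <= x * 2 by rewrite ler_pM2l.
  by nra.
have wh2 : x - 2 <= 4 * (x * x) * (w - h).
  have : x * 1 <= x * (4 * x * w) by rewrite ler_pM2l.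
  by nra.
have hw : w <= x * h.
  have : x * (4 * x * w) <= x * 2 by rewrite ler_pM2l.
  by rewrite -(ler_pM2l xx0); nra.
have /andP[] := truncn_itv t0; set v := Num.trunc _ => v1 v2.
have v0 : 0 <= v%:R :> R by [].
have v3 : v%:R * (w - h) <= 1 by rewrite -ler_pdivlMr // mul1r.
have v4 : 1 < (v%:R + 1) * (w - h) by rewrite natr1 -ltr_pdivrMr // mul1r.
set z : R := v%:R in v0 v3 v4 {v1 v2}.
have zx : 2 * x <= z.
  rewrite leNgt; apply/negP => zx.
  have : 2 * (x * x) * 1 < 2 * (x * x) * ((z + 1) * (w - h)).
    by rewrite ltr_pM2l // mulr_gt0.
  have : (z + 1) * (2 * (x * x) * (w - h)) <= (z + 1) * (x - 1).
    by rewrite ler_wpM2l // addr_ge0.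
  have : (z + 1) * (x - 1) <= (2 * x + 1) * (x - 1) by rewrite ler_wpM2r //; lra.
  by nra.
exists v; rewrite -/z.
  rewrite zx /=.
  have : z * (x - 2) <= z * (4 * (x * x) * (w - h)) by rewrite ler_wpM2l.
  have : 4 * (x * x) * (z * (w - h)) <= 4 * (x * x) * 1.
    by rewrite ler_wpM2l // mulr_ge0 // ltW.
  by nra.
have z3 : 0 < z by lra.
(* Rounding costs at most half of the allowed remainder, because [w <= x h] and [2 x <= z]. *)
have zh : w <= z * h / 2 by nra.
have -> : w - z^-1 = (z * w - 1) / z by field; rewrite gt_eqF.
rewrite mulrA ler_pdivlMr // ler_pdivrMr // mul1r.
apply/andP; split.
  have : 4 * (x * x) * (z * h / 2) <= 4 * (x * x) * (z * w - 1) by rewrite ler_pM2l ?mulr_gt0 //; nra.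
  by nra.
have : 4 * (x * x) * (z * w - 1) <= 4 * (x * x) * (z * h) by rewrite ler_pM2l ?mulr_gt0 //; nra.
by nra.
Qed.

Definition update (a : nat -> nat) (k v : nat) : nat -> nat :=
  fun i => if i == k then v else a i.

Lemma eq_recip_block (R : realType) d (a b : nat -> nat) n :
  (forall i, (n <= i < n + d)%N -> a i = b i) ->
  recip_block R d a n = recip_block R d b n.
Proof. by move=> e; rewrite /recip_block; congr _^-1; apply: eq_big_nat => i /e ->. Qed.

(** Subtracting the block and moving the window one place on turns [w] into [(v w - 1) / a_N], the
    quantity controlled by [greedy_step]. *)
Lemma greedy_block_step (R : realType) d (x : nat -> R) (a : nat -> nat) N (r : R) :
  (0 < d)%N -> (forall i, (N <= i)%N -> 4 <= x i) ->
  x (N + d)%N = x (N + d.-1)%N * x N ->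
  (forall i, (N <= i < N + d.-1)%N -> 2 * x i <= (a i)%:R <= 8 * x i) ->
  1 <= 4 * x (N + d.-1)%N * (r * \prod_(N <= i < N + d.-1) (a i)%:R) <= 2 ->
  exists2 v : nat, 2 * x (N + d.-1)%N <= v%:R <= 8 * x (N + d.-1)%N &
    let a' := update a (N + d.-1)%N v in
    1 <= 4 * x (N + d)%N * ((r - recip_block R d a' N) *
      \prod_(N.+1 <= i < N + d) (a' i)%:R) <= 2.
Proof.
case: d => // -[|e] _ /= x4 xrec aB.
  rewrite addn0 addn1 in xrec aB *; rewrite big_geq // mulr1.
  move=> /(greedy_step1 (x4 N (leqnn N)))[v vB vP]; exists v => //.
  rewrite /recip_block addn1 big_nat1.
  by rewrite /update eqxx big_geq // mulr1 xrec.
rewrite !addnS in xrec aB *; rewrite big_ltn; last by lia.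
set b : R := (a N)%:R; set P := \prod_(_ <= i < _) _.
have bB : 2 * x N <= b <= 8 * x N by apply: aB; lia.
move=> wB; have [v vB vP] := greedy_step (x4 (N + e).+1 ltac:(lia)) (x4 N (leqnn N)) wB bB.
exists v => //=.
set a' := update a _ v.
have P0 : 0 < P.
  rewrite /P big_nat_cond prodr_gt0 // => i; rewrite andbT => Ni.
  by have /andP[] := aB i ltac:(lia); have := x4 i ltac:(lia); lra.
have a'P : \prod_(N.+1 <= i < (N + e).+1) (a' i)%:R = P.
  by apply: eq_big_nat => i Ni; rewrite /a' /update ifF //; lia.
have v0 : 0 < v%:R :> R by have /andP[] := vB; have := x4 (N + e).+1 ltac:(lia); lra.
have b0 : 0 < b by have /andP[] := bB; have := x4 N (leqnn N); lra.
have PE : \prod_(N.+1 <= i < (N + e).+2) (a' i)%:R = P * v%:R.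
  by rewrite big_nat_recr ?a'P /=; [rewrite /a' /update eqxx|lia].
have -> : recip_block R e.+2 a' N = (b * (P * v%:R))^-1.
  rewrite /recip_block !addnS big_ltn; last by lia.
  by rewrite PE /a' /update ifF //; lia.
rewrite PE xrec.
suff -> : (r - (b * (P * v%:R))^-1) * (P * v%:R) = (v%:R * (r * (b * P)) - 1) / b by [].
by field; rewrite !gt_eqF.
Qed.

Lemma greedy_sequence (R : realType) d (x : nat -> R) n0 (f : nat -> nat) (r : R) :
  (0 < d)%N -> (forall i, (n0 <= i)%N -> 4 <= x i) ->
  (forall i, (n0 <= i)%N -> x (i + d)%N = x (i + d.-1)%N * x i) ->
  (forall i, (n0 <= i)%N -> 2 * x i <= (f i)%:R <= 8 * x i) ->
  1 <= 4 * x (n0 + d.-1)%N * (r * \prod_(n0 <= i < n0 + d.-1) (f i)%:R) <= 2 ->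
  exists a : nat -> nat, [/\ forall i, (i < n0)%N -> a i = f i,
    forall i, (n0 <= i)%N -> 2 * x i <= (a i)%:R <= 8 * x i &
    forall N, (n0 <= N)%N -> 1 <= 4 * x (N + d.-1)%N *
      ((r - \sum_(n0 <= n < N) recip_block R d a n) *
        \prod_(N <= i < N + d.-1) (a i)%:R) <= 2].
Proof.
move=> d0 x4 xrec fB fr.
(* The size bounds cover all indices from [n0] on, including those that still carry placeholder
   values of [f]. *)
pose good N (a : nat -> nat) :=
  (forall i, (n0 <= i)%N -> 2 * x i <= (a i)%:R <= 8 * x i) /\
  1 <= 4 * x (N + d.-1)%N * ((r - \sum_(n0 <= n < N) recip_block R d a n) *
    \prod_(N <= i < N + d.-1) (a i)%:R) <= 2.
(* The hypotheses are put inside the relation so that every state has a successor, as dependent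
   choice demands. *)
pose next (p p' : nat * (nat -> nat)) := (n0 <= p.1)%N -> good p.1 p.2 ->
  [/\ p'.1 = p.1.+1, good p'.1 p'.2 &
    forall i, i != (p.1 + d.-1)%N -> p'.2 i = p.2 i].
have step p : {p' | next p p'}.
  apply: cid; case: p => N a; have [nN|Nn] := leqP n0 N; last first.
    by exists (N, a); rewrite /next /= leqNgt Nn.
  have [[aB aN]|bad] := pselect (good N a); last by exists (N, a) => _ /bad.
  have [|||v vB] := greedy_block_step d0 _ _ _ aN.
  - by move=> i Ni; apply: x4; lia.
  - exact: xrec.
  - by move=> i Ni; apply: aB; lia.
  set a' := update _ _ _ => a'N; exists (N.+1, a') => _ _ /=; split=> //; last first.
    by move=> i /negbTE iN; rewrite /a' /update iN.
  split=> [i n0i|]; first by rewrite /a' /update; case: eqP => [->//|_]; apply: aB.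
  have -> : (N.+1 + d.-1 = N + d)%N by lia.
  rewrite big_nat_recr //= opprD addrA.
  suff -> : \sum_(n0 <= n < N) recip_block R d a' n =
      \sum_(n0 <= n < N) recip_block R d a n by [].
  apply: eq_big_nat => n nN'; apply: eq_recip_block => i ni.
  by rewrite /a' /update ifF //; lia.
have [F [F0 FS]] := dependent_choice step (n0, f).
have FP k : (F k).1 = (n0 + k)%N /\ good (F k).1 (F k).2.
  elim: k => [|k [IH1 IH2]].
    by rewrite F0 addn0 /= /good [\sum_(_ <= _ < _) _]big_geq // subr0.
  have [|e1 g _] := FS k _ IH2; first by rewrite IH1 leq_addr.
  by split=> //; rewrite e1 IH1 addnS.
have Fstab k k' i : (k <= k')%N -> (i < n0 + k + d.-1)%N -> (F k').2 i = (F k).2 i.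
  move=> /subnK <- ik; elim: (k' - k)%N => // j IH; rewrite addSn -{}IH.
  have [e1 g] := FP (j + k)%N; have [|_ _ ->//] := FS _ _ g; rewrite e1 ?leq_addr //.
  by apply/eqP; lia.
(* Stage [k] has settled all indices below [n0 + k + d - 1], so index [i] is final at stage [i + 1],
   even if [n0 = 0] and [d = 1]. *)
pose a i := (F i.+1).2 i.
have aE k i : (i < n0 + k + d.-1)%N -> a i = (F k).2 i.
  move=> ik; rewrite /a; have [ki|ki] := leqP k i.+1; first exact: Fstab.
  by rewrite -(@Fstab i.+1 k) //; lia.
exists a; split=> [i i0|i i0|N nN].
- by rewrite (aE 0%N) ?F0 //; lia.
- by have [_ [/(_ i i0)]] := FP i.+1.
- have [] := FP (N - n0)%N; rewrite subnKC // => -> [_].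
  suff [-> ->] : \sum_(n0 <= n < N) recip_block R d a n =
       \sum_(n0 <= n < N) recip_block R d (F (N - n0)%N).2 n /\
    \prod_(N <= i < N + d.-1) (a i)%:R =
       \prod_(N <= i < N + d.-1) ((F (N - n0)%N).2 i)%:R :> R by [].
  split; last by apply: eq_big_nat => i Ni; rewrite (aE (N - n0)%N) //; lia.
  apply: eq_big_nat => n nN'; apply: eq_recip_block => i ni.
  by rewrite (aE (N - n0)%N) //; lia.
Qed.

(** * The starting index and the limit of the growth rate *)

Lemma expR_ge_sqr (R : realType) (y : R) : 0 <= y -> (y / 2) ^+ 2 <= expR y.
Proof.
move=> y0; have -> : expR y = expR (y / 2) ^+ 2.
  by rewrite -expRM_natl; congr expR; field.
by rewrite ler_sqr ?nnegrE ?expR_ge0 ?divr_ge0 //; apply: le_trans (expR_ge1Dx _); lra.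
Qed.

(** These conditions make the final sequence strictly increasing: [4 x_n < x_(n+1)] separates the
    ranges [[2 x_n, 8 x_n]], and [n0 <= x_(n0)] lets the sequence begin with [a_i = i] for
    [i < n0]. *)
Lemma large_start (R : realType) (psi c : R) : 1 < psi -> 0 < c ->
  exists n0, [/\ (1 <= n0)%N, n0%:R <= expR (c * psi ^+ n0) &
    forall n, (n0 <= n)%N -> 4 <= expR (c * psi ^+ n) /\
      4 * expR (c * psi ^+ n) < expR (c * psi ^+ n.+1)].
Proof.
move=> psi1 c0; have psi0 : 0 < psi by apply: lt_trans psi1.
have p0 : 0 < psi - 1 by rewrite subr_gt0.
have pc0 : 0 < c * (psi - 1) by rewrite mulr_gt0.
(* The two summands force [c psi^n (psi - 1) >= 4] and [c psi^n >= 4]. *)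
have [k1 _ k1P] := (cvgryPge _).1 (cvg_exprn_pinfty psi1) (4 / (c * (psi - 1)) + 4 / c).
set t := c * (psi - 1) / 2.
have t0 : 0 < t by rewrite divr_gt0.
have tt0 : 0 <= (t ^+ 2)^-1 by rewrite invr_ge0 sqr_ge0.
(* From [n0 >= 1 / t^2] follows [n0 <= (n0 t)^2], and [n0 t <= c psi^n0 / 2] by Bernoulli's
   inequality. *)
exists (maxn 1 (maxn k1 (Num.bound (t ^+ 2)^-1))); set n0 := maxn _ _; split.
- by rewrite leq_maxl.
- have nt : (t ^+ 2)^-1 <= n0%:R.
    apply: (le_trans (ltW (archi_boundP tt0))); rewrite ler_nat.
    by rewrite /n0; lia.
  apply: le_trans (expR_ge_sqr _); last by rewrite mulr_ge0 ?exprn_ge0 ?(ltW c0) ?(ltW psi0).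
  have h : n0%:R * t <= c * psi ^+ n0 / 2.
    rewrite /t mulrA ler_pM2r ?invr_gt0 // mulrCA ler_pM2l //.
    exact: natr_mulB1_le_exprn (ltW psi1).
  apply: (@le_trans _ _ ((n0%:R * t) ^+ 2)); last first.
    have nt0 : 0 <= n0%:R * t by rewrite mulr_ge0 // ltW.
    by rewrite ler_sqr ?nnegrE // (le_trans nt0).
  rewrite exprMn expr2 -mulrA ler_peMr //.
  by rewrite -ler_pdivrMr ?exprn_gt0 // mul1r.
- move=> n nn; have := k1P n; rewrite /= => /(_ ltac:(lia)) kn.
  have a1 : 4 / (c * (psi - 1)) <= psi ^+ n.
    by apply: le_trans kn; rewrite lerDl divr_ge0 // ltW.
  have a2 : 4 / c <= psi ^+ n.
    by apply: le_trans kn; rewrite lerDr divr_ge0 // ltW.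
  rewrite ler_pdivrMr // in a1; rewrite ler_pdivrMr // in a2.
  split; first by apply: le_trans (expR_ge1Dx _); lra.
  have -> : c * psi ^+ n.+1 = psi ^+ n * (c * (psi - 1)) + c * psi ^+ n.
    by rewrite exprS; ring.
  rewrite expRD ltr_pM2r ?expR_gt0 //; apply: lt_le_trans (expR_ge1Dx _); lra.
Qed.

Lemma recip_block_rational (R : realType) d (a : nat -> nat) n :
  recip_block R d a n = ratr (\prod_(n <= i < n + d) (a i)%:R)^-1.
Proof.
rewrite /recip_block fmorphV rmorph_prod; congr _^-1.
by apply: eq_bigr => i _; rewrite /= ratr_nat.
Qed.

Lemma cvg_exprnV0 (R : realType) (x : R) : 1 < x -> x ^- n @[n --> \oo] --> 0.
Proof.
move=> x1; have x0 : 0 < x by apply: lt_trans x1.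
under eq_fun do rewrite -exprVn.
by apply: cvg_expr; rewrite ger0_norm ?invr_ge0 ?(ltW x0) // invf_lt1.
Qed.

Lemma growth_cvg (R : realType) (psi c : R) (a : nat -> nat) n0 : 1 < psi ->
  (forall n, (n0 <= n)%N ->
    2 * expR (c * psi ^+ n) <= (a n)%:R <= 8 * expR (c * psi ^+ n)) ->
  (a n)%:R `^ (1 / psi ^+ n) @[n --> \oo] --> expR c.
Proof.
move=> psi1 aB; have psi0 : 0 < psi by apply: lt_trans psi1.
apply: (@cvg_trans _ (expR (1 / psi ^+ n * ln (a n)%:R) @[n --> \oo])).
  apply: near_eq_cvg; near=> n.
  have nn : (n0 <= n)%N by near: n; exists n0.
  rewrite /powR gt_eqF //; have /andP[an _] := aB n nn.
  by apply: lt_le_trans an; rewrite mulr_gt0 ?expR_gt0.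
apply: continuous_cvg; first exact: continuous_expR.
apply: (@squeeze_cvgr _ _ _ _ (fun=> c) (fun n => c + ln 8 * psi ^- n)).
- near=> n.
  have nn : (n0 <= n)%N by near: n; exists n0.
  have /andP[a1 a2] := aB n nn.
  have e0 := expR_gt0 (c * psi ^+ n).
  have a0 : 0 < (a n)%:R :> R by apply: lt_le_trans a1; rewrite mulr_gt0.
  have p0 : 0 < psi ^+ n by rewrite exprn_gt0.
  rewrite mul1r mulrC ler_pdivlMr // ler_pdivrMr // mulrDl divfK ?gt_eqF //.
  apply/andP; split.
    by rewrite -[leLHS]expRK ler_ln ?posrE // (le_trans _ a1) // ler_peMl ?ltW // ltr1n.
  by rewrite -[X in X + _]expRK addrC -lnM ?posrE // ler_ln ?posrE // mulr_gt0.
- exact: cvg_cst.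
- rewrite -[X in _ --> X]addr0; apply: cvgD; first exact: cvg_cst.
  rewrite -[X in _ --> X](mulr0 (ln 8)); apply: cvgM; first exact: cvg_cst.
  exact: cvg_exprnV0.
Unshelve. all: by end_near. Qed.

(** * A rational sum with prescribed growth *)

Lemma block_sum_rational (R : realType) (d : nat) (psi C : R) :
  (0 < d)%N -> 1 < psi -> psi ^+ d = psi ^+ d.-1 + 1 -> 1 < C ->
  exists a : nat -> nat,
    [/\ forall n, (1 <= n)%N -> (0 < a n)%N,
        forall n, (1 <= n)%N -> (a n < a n.+1)%N,
        (a n)%:R `^ (1 / psi ^+ n) @[n --> \oo] --> C &
        exists S : R, block_sum d a S /\ rational S].
Proof.
move=> d0 psi1 psiE C1; have psi0 : 0 < psi by apply: lt_trans psi1.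
pose c := ln C; have c0 : 0 < c by rewrite ln_gt0.
have [n0 [n01 n0x x4]] := large_start psi1 c0.
pose x n := expR (c * psi ^+ n).
have xrec i : x (i + d)%N = x (i + d.-1)%N * x i.
  by rewrite /x (psi_exprD i psiE) mulrDr expRD.
pose f i := if (i < n0)%N then i else (Num.trunc (2 * x i)).+1.
have fB i : (n0 <= i)%N -> 2 * x i <= (f i)%:R <= 8 * x i.
  move=> ni; have [xi _] := x4 i ni; rewrite /f ltnNge ni /= -natr1.
  have : 0 <= 2 * x i by rewrite mulr_ge0 ?expR_ge0.
  move=> /truncn_itv /andP[]; rewrite -natr1 -/(x i) in xi * => h1 h2.
  by apply/andP; split; lra.
pose P : R := \prod_(n0 <= i < n0 + d.-1) (f i)%:R.
have P0 : 0 < P.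
  rewrite /P big_nat_cond prodr_gt0 // => i; rewrite andbT => /andP[/fB /andP[fi _] _].
  by apply: lt_le_trans fi; rewrite mulr_gt0 ?expR_gt0.
have xP0 : 0 < 4 * x (n0 + d.-1)%N * P by rewrite !mulr_gt0 ?expR_gt0.
(* Density of the rationals supplies a starting remainder that satisfies the greedy invariant at
   [N = n0]. The sum of the series will be [r0] plus the finitely many rational terms before
   [n0]. *)
have [r0] : exists q : rat, ratr q \in
    `](4 * x (n0 + d.-1)%N * P)^-1, (2 / (4 * x (n0 + d.-1)%N * P))[%R.
  by apply: rat_in_itvoo; rewrite -[ltLHS]mul1r ltr_pM2r ?invr_gt0 // ltr1n.
rewrite in_itv /= => /andP[].
rewrite -[X in X < _]mul1r ltr_pdivrMr // ltr_pdivlMr // => r01 r02.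
have [|a [af aB aN]] := @greedy_sequence R d x n0 f (ratr r0) d0
    (fun i ni => (x4 i ni).1) (fun i _ => xrec i) fB.
  by rewrite -/P [ratr _ * P]mulrC mulrA ![_ * ratr _]mulrC !ltW.
have apos n : (1 <= n)%N -> (0 < a n)%N.
  move=> n1; have [nn|/aB/andP[an _]] := ltnP n n0; first by rewrite af // /f nn.
  by rewrite -(ltr0n R); apply: lt_le_trans an; rewrite mulr_gt0 ?expR_gt0.
exists a; split=> //.
- move=> n n1; have [nn|nn] := ltnP n n0; last first.
    have /andP[_ an] := aB n nn; have /andP[an' _] := aB n.+1 (leqW nn).
    rewrite -(ltr_nat R); have [_] := x4 n nn; rewrite -/(x n) -/(x n.+1); lra.
  rewrite {1}af // {1}/f nn; have [nn'|nn'] := ltnP n.+1 n0.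
    by rewrite af // /f nn'.
  have nE : n.+1 = n0 by lia.
  have /andP[an _] := aB n.+1 nn'; rewrite -ltnS nE -(ltr_nat R) -natr1; rewrite nE in an.
  have := expR_gt0 (c * psi ^+ n0); move: n0x an; rewrite -/(x n0); lra.
- have -> : C = expR c by rewrite lnK // posrE (lt_trans ltr01).
  exact: growth_cvg aB.
pose S0 : R := \sum_(1 <= n < n0) recip_block R d a n.
exists (S0 + ratr r0); split; last first.
  exists (\sum_(1 <= n < n0) (\prod_(n <= i < n + d) (a i)%:R)^-1 + r0) => //.
  rewrite rmorphD rmorph_sum /=; congr (_ + _).
  by apply: eq_bigr => n _; rewrite recip_block_rational.
pose rem N : R := ratr r0 - \sum_(n0 <= n < N) recip_block R d a n.
apply: (@cvg_trans _ (S0 + ratr r0 - rem N @[N --> \oo])).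
  apply: near_eq_cvg; near=> N.
  rewrite [in RHS](@big_cat_nat _ _ _ n0) //=; last by near: N; exists n0.
  by rewrite /rem -/S0; ring.
suff rem0 : rem N @[N --> \oo] --> 0.
  by have := cvgB (cvg_cst (S0 + ratr r0)) rem0; rewrite subr0; apply.
(* The invariant and [Q >= 1] give [0 < rem N <= 1 / (2 x_(N+d-1))], while
   [x_(N+d-1) >= c psi^N]. *)
apply: (@squeeze_cvgr _ _ _ _ (fun=> 0) (fun N => c^-1 * psi ^- N)); last 2 first.
- exact: cvg_cst.
- rewrite -[X in _ --> X](mulr0 c^-1); apply: cvgM; first exact: cvg_cst.
  exact: cvg_exprnV0.
near=> N; have nN : (n0 <= N)%N by near: N; exists n0.
have /andP[] := aN N nN; rewrite -/(rem N); set Q := \prod_(_ <= _ < _) _.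
have Q1 : 1 <= Q.
  rewrite /Q big_nat_cond; elim/big_ind: _ => // [y z|i]; first exact: mulr_ege1.
  by rewrite andbT => /andP[Ni _]; rewrite ler1n apos //; lia.
have xN : c * psi ^+ N <= x (N + d.-1)%N.
  apply: le_trans (expR_ge1Dx _); apply: (@le_trans _ _ (c * psi ^+ (N + d.-1))).
    by rewrite ler_pM2l // exprD ler_peMr ?exprn_ge0 ?exprn_ege1 ?(ltW psi0) ?(ltW psi1).
  by rewrite lerDr.
have cp0 : 0 < c * psi ^+ N by rewrite mulr_gt0 ?exprn_gt0.
move=> h1 h2.
have rQ0 : 0 < rem N * Q.
  by rewrite -(pmulr_rgt0 _ (_ : 0 < 4 * x (N + d.-1)%N)); [lra|lra].
have r0' : 0 < rem N by rewrite -(pmulr_lgt0 _ (_ : 0 < Q)) //; lra.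
rewrite ltW //= -invfM -[leRHS]mul1r ler_pdivlMr //.
have : rem N <= rem N * Q by rewrite ler_peMr // ltW.
by nra.
Unshelve. all: by end_near. Qed.

Theorem theorem1 (R : realType) (d : nat) (psi : R)
    (d_gt0 : (0 < d)%N) (psi_gt1 : 1 < psi)
    (psi_eq : psi ^+ d = psi ^+ d.-1 + 1) :
  (forall a : nat -> nat,
      (forall n : nat, (1 <= n)%N -> (0 < a n)%N) ->
      (forall n : nat, (1 <= n)%N -> (a n <= a n.+1)%N) ->
      (a n)%:R `^ (1 / psi ^+ n) @[n --> \oo] --> +oo ->
      exists S : R, block_sum d a S /\ irrational S)
  /\
  (forall C : R, 1 < C ->
      exists a : nat -> nat,
        [/\ forall n : nat, (1 <= n)%N -> (0 < a n)%N,
            forall n : nat, (1 <= n)%N -> (a n < a n.+1)%N,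
            (a n)%:R `^ (1 / psi ^+ n) @[n --> \oo] --> C &
            exists S : R, block_sum d a S /\ rational S]).
Proof.
split=> [a a_gt0 a_mono a_growth|C C_gt1].
  exact: block_sum_irrational d_gt0 psi_gt1 psi_eq a_gt0 a_mono a_growth.
exact: block_sum_rational d_gt0 psi_gt1 psi_eq C_gt1.
Qed.
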